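(* Let $P$ be a subgroup of $I_K(\mathfrak{n})$ with $P_{K,1}(\mathfrak{n})\subseteq P\subseteq P_K(\mathfrak{n})$ and let $\Gamma$ be a subgroup of $\mathrm{SL}_2(\mathbb{Z})$. The map $\phi_\Gamma:\mathcal{Q}_N(d_K)/\sim_\Gamma\to I_K(\mathfrak{n})/P$, $[Q]\mapsto[[\omega_Q,1]]$, is a well-defined bijection if and only if $\Gamma$ satisfies property (P): for every $Q\in\mathcal{Q}_N(d_K)$ and every $\gamma\in\mathrm{SL}_2(\mathbb{Z})$ with $Q^{\gamma^{-1}}\in\mathcal{Q}_N(d_K)$, one has $j(\gamma,\omega_Q)\mathcal{O}_K\in P$ if and only if $\gamma\in\Gamma\cdot I_{\omega_Q}$. In that case $\mathcal{Q}_N(d_K)/\sim_\Gamma$ acquires (by transport of structure via $\phi_\Gamma$) a group structure isomorphic to $I_K(\mathfrak{n})/P$.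
   Context: Let $K$ be an imaginary quadratic field with discriminant $d_K$ and ring of integers $\mathcal{O}_K$. Let $N$ be a positive integer and $\mathfrak{n}=N\mathcal{O}_K$. $I_K(\mathfrak{n})$ denotes the group of fractional ideals of $K$ relatively prime to $\mathfrak{n}$, $P_K(\mathfrak{n})$ its subgroup of principal fractional ideals, and $P_{K,1}(\mathfrak{n})=\{\nu\mathcal{O}_K:\nu\in K^*,\ \nu\equiv^*1\pmod{\mathfrak{n}}\}$, where $\equiv^*$ is multiplicative congruence. $\mathcal{Q}(d_K)$ is the set of primitive positive definite binary quadratic forms $ax^2+bxy+cy^2\in\mathbb{Z}[x,y]$ with $b^2-4ac=d_K$, and $\mathcal{Q}_N(d_K)=\{ax^2+bxy+cy^2\in\mathcal{Q}(d_K):\gcd(N,a)=1\}$. For $Q=ax^2+bxy+cy^2\in\mathcal{Q}(d_K)$, $\omega_Q=(-b+\sqrt{d_K})/(2a)\in\mathbb{H}$ and $[\omega_Q,1]=\mathbb{Z}\omega_Q+\mathbb{Z}$ (a fractional ideal of $K$). For $\gamma\in\mathrm{SL}_2(\mathbb{Z})$, $Q^\gamma(x,y)=Q(\gamma\,(x,y)^T)$. For a subgroup $\Gamma\subseteq\mathrm{SL}_2(\mathbb{Z})$, the relation $\sim_\Gamma$ on $\mathcal{Q}_N(d_K)$ is: $Q\sim_\Gamma Q'$ iff $Q'=Q^\gamma$ for some $\gamma\in\Gamma$. For $\gamma=\begin{bmatrix}a&b\\c&d\end{bmatrix}\in\mathrm{SL}_2(\mathbb{Z})$ and $\tau\in\mathbb{H}$,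 $j(\gamma,\tau)=c\tau+d$. $I_{\omega}$ denotes the isotropy subgroup of $\omega\in\mathbb{H}$ in $\mathrm{SL}_2(\mathbb{Z})$ under the action by fractional linear transformations. *)

(* Defs.v *)
(* The imaginary quadratic field K = Q(sqrt d_K) is realised
   inside the algebraic numbers algC; fractional ideals are subsets of algC. *)
From HB Require Import structures.
From mathcomp Require Import all_boot all_order all_algebra all_field.
Set Implicit Arguments. Unset Strict Implicit. Unset Printing Implicit Defensive.
Import Order.TTheory GRing.Theory Num.Theory.
Local Open Scope ring_scope.

Definition cset := algC -> Prop.

Definition sqfree_nat (m : nat) : Prop :=
  forall k : nat, (1 < k)%N -> ~~ (k * k %| m)%N.
Definition fund_disc (d : int) : Prop :=
  ((d %% 4)%Z = 1 /\ sqfree_nat `|d|%N) \/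
  (exists m : int, d = 4 * m /\ ((m %% 4)%Z = 2 \/ (m %% 4)%Z = 3)
                   /\ sqfree_nat `|m|%N).

(* sqrt(d_K), with nonnegative imaginary part *)
Definition sqd (d : int) : algC := sqrtC (d%:~R).

Definition inK (d : int) (x : algC) : Prop :=
  exists a b : rat, x = ratr a + ratr b * sqd d.

Definition OK (d : int) : cset := fun x => inK d x /\ x \in Aint.

Definition is_frac (d : int) (I : cset) : Prop :=
  (forall x, I x -> inK d x) /\
  I 0 /\
  (forall x y, I x -> I y -> I (x + y)) /\
  (forall r x, OK d r -> I x -> I (r * x)) /\
  (exists x, I x /\ x != 0) /\
  (exists c, [/\ OK d c, c != 0 & forall x, I x -> OK d (c * x)]).

Definition mulI (I J : cset) : cset := fun x =>
  exists s : seq (algC * algC),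
    (forall p, p \in s -> I p.1 /\ J p.2) /\ x = \sum_(p <- s) p.1 * p.2.

Definition pid (d : int) (nu : algC) : cset := fun x =>
  exists y, OK d y /\ x = nu * y.

(* integral ideal A coprime to n = N O_K, i.e. A + n = O_K *)
Definition int_coprime (d : int) (N : nat) (A : cset) : Prop :=
  [/\ is_frac d A, (forall x, A x -> OK d x) &
      exists a b, [/\ A a, OK d b & a + N%:R * b = 1]].

(* I_K(n): fractional ideals relatively prime to n (I = A B^-1 with A, B
   integral and coprime to n) *)
Definition IK (d : int) (N : nat) (I : cset) : Prop :=
  is_frac d I /\
  exists A B, [/\ int_coprime d N A, int_coprime d N B & mulI I B = A].

Definition PK (d : int) (N : nat) (I : cset) : Prop :=
  IK d N I /\ exists nu, [/\ inK d nu, nu != 0 & I = pid d nu].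

Definition mcong1 (d : int) (N : nat) (nu : algC) : Prop :=
  exists al be, OK d al /\ OK d be /\ be != 0 /\ nu = al / be /\
    int_coprime d N (pid d al) /\ int_coprime d N (pid d be) /\
    pid d N%:R (al - be).

Definition PK1 (d : int) (N : nat) (I : cset) : Prop :=
  exists nu, [/\ inK d nu, nu != 0, mcong1 d N nu & I = pid d nu].

Definition subgroupIK (d : int) (N : nat) (P : cset -> Prop) : Prop :=
  [/\ (forall I, P I -> IK d N I),
      P (OK d),
      (forall I J, P I -> P J -> P (mulI I J)) &
      (forall I, P I -> exists J, P J /\ mulI I J = OK d)].

Definition equivP (P : cset -> Prop) (I J : cset) : Prop :=
  exists H, P H /\ J = mulI H I.

(* binary quadratic forms a x^2 + b x y + c y^2 *)
Definition form := (int * int * int)%type.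
Definition fa (Q : form) := Q.1.1.
Definition fb (Q : form) := Q.1.2.
Definition fc (Q : form) := Q.2.

Definition inQ (d : int) (Q : form) : Prop :=
  [/\ gcdz (gcdz (fa Q) (fb Q)) (fc Q) = 1, 0 < fa Q &
      fb Q ^+ 2 - 4 * fa Q * fc Q = d].

Definition inQN (d : int) (N : nat) (Q : form) : Prop :=
  inQ d Q /\ gcdz N%:Z (fa Q) = 1.

Definition omega (d : int) (Q : form) : algC :=
  (- (fb Q)%:~R + sqd d) / (2 * (fa Q)%:~R).

Definition lat (w : algC) : cset := fun x =>
  exists m n : int, x = m%:~R * w + n%:~R.

Definition SL2 (g : 'M[int]_2) : Prop := \det g = 1.

(* Q^g (x, y) = Q (g (x, y)^T), g = [p q; r s] *)
Definition fact_form (Q : form) (g : 'M[int]_2) : form :=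
  let p := g 0 0 in let q := g 0 1 in let r := g 1 0 in let s := g 1 1 in
  (fa Q * p ^+ 2 + fb Q * p * r + fc Q * r ^+ 2,
   2 * fa Q * p * q + fb Q * (p * s + q * r) + 2 * fc Q * r * s,
   fa Q * q ^+ 2 + fb Q * q * s + fc Q * s ^+ 2).

Definition subgroupSL2 (G : 'M[int]_2 -> Prop) : Prop :=
  [/\ (forall g, G g -> SL2 g), G 1%:M,
      (forall g h, G g -> G h -> G (g *m h)) &
      (forall g, G g -> G (invmx g))].

Definition simG (G : 'M[int]_2 -> Prop) (Q Q' : form) : Prop :=
  exists g, G g /\ Q' = fact_form Q g.

Definition jfac (g : 'M[int]_2) (tau : algC) : algC :=
  (g 1 0)%:~R * tau + (g 1 1)%:~R.

Definition mobius (g : 'M[int]_2) (tau : algC) : algC :=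
  ((g 0 0)%:~R * tau + (g 0 1)%:~R) / jfac g tau.
Definition isotropy (w : algC) (g : 'M[int]_2) : Prop :=
  SL2 g /\ mobius g w = w.

Definition prodGI (G : 'M[int]_2 -> Prop) (w : algC) (g : 'M[int]_2) : Prop :=
  exists g1 g2, [/\ G g1, isotropy w g2 & g = g1 *m g2].

Definition propP (d : int) (N : nat) (P : cset -> Prop)
    (G : 'M[int]_2 -> Prop) : Prop :=
  forall Q g, inQN d N Q -> SL2 g -> inQN d N (fact_form Q (invmx g)) ->
    (P (pid d (jfac g (omega d Q))) <-> prodGI G (omega d Q) g).

(* phi_Gamma : Q_N(d)/~_Gamma -> I_K(n)/P, [Q] |-> [[w_Q,1]], is a
   well-defined bijection (quotients as setoids) *)
Definition phi_wd_bij (d : int) (N : nat) (P : cset -> Prop)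
    (G : 'M[int]_2 -> Prop) : Prop :=
  [/\ (forall Q, inQN d N Q -> IK d N (lat (omega d Q))),
      (forall Q Q', inQN d N Q -> inQN d N Q' -> simG G Q Q' ->
         equivP P (lat (omega d Q)) (lat (omega d Q'))),
      (forall Q Q', inQN d N Q -> inQN d N Q' ->
         equivP P (lat (omega d Q)) (lat (omega d Q')) -> simG G Q Q') &
      (forall I, IK d N I -> exists Q, inQN d N Q /\
         equivP P I (lat (omega d Q)))].

(* Main.v *)
(* For a form Q of discriminant d the lattice of omega_Q determines omega_Q up to
   SL2(Z), and lat(omega_Q) = j(g, omega_Q) lat(g omega_Q), where g omega_Q is the root of
   the form Q^(g^-1). Hence lat(omega_Q) and lat(omega_Q') differ by a principal ideal
   (nu) exactly when Q' = Q^(g^-1) with nu j(g, omega_Q) a unit, and property (P) says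
   that (nu) lies in P exactly when g can be moved into Gamma by the stabiliser of Q.
   That phi_Gamma takes values in I_K(n) and is onto holds for every Gamma. For
   surjectivity, write I B = A with A, B integral and prime to n. An element of A that is
   1 mod N lies in I; moving it by N I makes it a primitive vector nu of the lattice I,
   still with nu =* 1 mod n. Completing nu to a basis (xi, nu) of I gives
   nu^-1 I = [xi/nu, 1], and xi/nu is, up to sign, omega_Q for some Q; the leading
   coefficient of Q is prime to N because some element congruent to 1 mod N multiplies
   xi/nu into O_K. *)
Require Import Defs.
From HB Require Import structures.
From mathcomp Require Import all_boot all_order all_algebra all_field.
From mathcomp Require Import zify ring.
From Stdlib Require Import Classical FunctionalExtensionality PropExtensionality.
Import Order.TTheory GRing.Theory Num.Theory.
Local Open Scope ring_scope.

(** * The ring of integers *)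

(** Ideals are predicates compared by [=]; the two extensionality axioms reduce this to having the
    same members. *)
Lemma cset_eq (I J : cset) : (forall x, I x <-> J x) -> I = J.
Proof.
move=> IJ; apply: functional_extensionality => x.
exact: propositional_extensionality.
Qed.

Lemma ratr_Aint (q : rat) : (ratr q : algC) \in Aint -> exists k : int, q = k%:~R.
Proof.
move=> qA; have /intrP[k kE] : (ratr q : algC) \in Num.int.
  by apply: Cint_rat_Aint => //; apply: Crat_rat.
exists k; apply: (fmorph_inj (ratr : {rmorphism rat -> algC})).
by rewrite /= kE ratr_int.
Qed.

Lemma sqfree_int_sqr (m k : int) :
  sqfree_nat `|m|%N -> 0 < k -> (k * k %| m)%Z -> k = 1.
Proof.
move=> msf k0 kkm; apply/eqP; apply: contraT => k1.
have := msf `|k|%N; rewrite -abszM.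
have -> : (1 < `|k|)%N by lia.
by move=> /(_ isT) /negP; case; move: kkm; rewrite dvdzE.
Qed.

(** In lowest terms the square of the denominator of [q] divides [numq q ^+ 2 * m], hence [m], so it
    is 1 because [m] is squarefree. *)
Lemma sqfree_rat_int (m n : int) (q : rat) :
  sqfree_nat `|m|%N -> q ^+ 2 * m%:~R = n%:~R -> exists k : int, q = k%:~R.
Proof.
move=> msf qmn; exists (numq q).
suff dq1 : denq q = 1 by rewrite -[LHS]divq_num_den dq1 divr1.
apply: (sqfree_int_sqr m) => //.
have qE : numq q ^+ 2 * m = n * denq q ^+ 2.
  apply: (@intr_inj rat); rewrite !rmorphM /= -qmn.
  by rewrite !numqE; ring.
have : (denq q ^+ 2 %| numq q ^+ 2 * m)%Z by rewrite qE dvdz_mull.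
rewrite Gauss_dvdzr ?expr2 //.
have := coprime_num_den q; rewrite coprimezE !abszM => cop.
by rewrite coprimeMl !coprimeMr coprime_sym cop.
Qed.

Lemma sqr_sqd (d : int) : sqd d ^+ 2 = d%:~R.
Proof. exact: sqrtCK. Qed.

Lemma sqd_neq0 (d : int) : d < 0 -> sqd d != 0.
Proof.
move=> d0; apply/eqP => S0; have := sqr_sqd d.
by rewrite S0 expr0n => /esym/eqP; rewrite intr_eq0; lia.
Qed.

Lemma conj_sqd (d : int) : d < 0 -> (sqd d)^* = - sqd d.
Proof.
move=> d0; have := sqr_sqd d; set S := sqd d => S2.
have : S^* ^+ 2 == S ^+ 2 by rewrite -rmorphXn /= S2 conj_intr ?intr_int.
rewrite eqf_sqr => /orP[|/eqP//]; rewrite -CrealE => Sr.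
have : (0 : algC) <= d%:~R by rewrite -S2 real_exprn_even_ge0.
by rewrite ler0z; lia.
Qed.

Lemma conjC_ratr (q : rat) : (ratr q : algC)^* = ratr q.
Proof. by rewrite conj_Crat ?Crat_rat. Qed.

Lemma conjC_ratr_sqd (d : int) (a b : rat) :
  d < 0 -> (ratr a + ratr b * sqd d)^* = ratr a - ratr b * sqd d.
Proof.
by move=> d0; rewrite rmorphD [X in _ + X]rmorphM /= !conjC_ratr conj_sqd // mulrN.
Qed.

(** Conjugation changes the sign of sqrt d, so adding the conjugate equation isolates [a]. *)
Lemma ratr_sqd_eq0 (d : int) (a b : rat) :
  d < 0 -> ratr a + ratr b * sqd d = 0 -> a = 0 /\ b = 0.
Proof.
move=> d0 e; have e' := congr1 (fun z : algC => z^*) e.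
rewrite /= conjC_ratr_sqd // rmorph0 in e'.
have S0 := sqd_neq0 d d0.
have a0 : ratr a = ((ratr a + ratr b * sqd d) + (ratr a - ratr b * sqd d)) / 2 by field.
rewrite e e' addr0 mul0r in a0.
move: e; rewrite a0 add0r => /eqP; rewrite mulf_eq0 (negPf S0) orbF => /eqP b0.
by split; apply/eqP; rewrite -(fmorph_eq0 (ratr : {rmorphism rat -> algC})) /= ?a0 ?b0.
Qed.

Lemma intr_sqd_eq0 (d m n : int) :
  d < 0 -> m%:~R + n%:~R * sqd d = 0 -> m = 0 /\ n = 0.
Proof.
move=> d0; rewrite -(ratr_int _ m) -(ratr_int _ n) => /ratr_sqd_eq0 [//|/eqP + /eqP].
by rewrite !intr_eq0 => /eqP-> /eqP->.
Qed.

Lemma inK_int (d k : int) : inK d k%:~R.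
Proof. by exists k%:~R, 0; rewrite rmorph0 mul0r addr0 ratr_int. Qed.

Lemma inK_sqd (d : int) : inK d (sqd d).
Proof. by exists 0, 1; rewrite rmorph0 rmorph1 mul1r add0r. Qed.

Lemma inKD (d : int) (x y : algC) : inK d x -> inK d y -> inK d (x + y).
Proof.
move=> [a [b ->]] [a' [b' ->]]; exists (a + a'), (b + b').
by ring.
Qed.

Lemma inKM (d : int) (x y : algC) : inK d x -> inK d y -> inK d (x * y).
Proof.
move=> [a [b ->]] [a' [b' ->]].
exists (a * a' + b * b' * d%:~R), (a * b' + b * a').
by have S2 := sqr_sqd d; ring: S2.
Qed.

Lemma inK_conj (d : int) (x : algC) : d < 0 -> inK d x -> inK d x^*.
Proof.
move=> d0 [a [b ->]]; exists a, (- b).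
by rewrite conjC_ratr_sqd // rmorphN mulNr.
Qed.

Lemma inK_rat (d : int) (q : rat) : inK d (ratr q).
Proof. by exists q, 0; rewrite rmorph0 mul0r addr0. Qed.

Lemma ratr_sqd_norm (d : int) (a b : rat) :
  (ratr a + ratr b * sqd d) * (ratr a - ratr b * sqd d)
    = ratr (a ^+ 2 - b ^+ 2 * d%:~R).
Proof. by have S2 := sqr_sqd d; ring: S2. Qed.

Lemma inKV (d : int) (x : algC) : d < 0 -> inK d x -> inK d x^-1.
Proof.
move=> d0 xK; have [->|x0] := eqVneq x 0; first by rewrite invr0; apply: (inK_int d 0).
have [a [b xE]] := xK.
have nE : x * x^* = ratr (a ^+ 2 - b ^+ 2 * d%:~R).
  by rewrite xE conjC_ratr_sqd // ratr_sqd_norm.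
have n0 : x * x^* != 0 by rewrite mulf_neq0 // conjC_eq0.
have -> : x^-1 = x^* * (x * x^*)^-1.
  by rewrite invfM mulrCA mulfV ?mulr1 ?conjC_eq0.
by apply: inKM; [exact: inK_conj | rewrite nE -fmorphV; exact: inK_rat].
Qed.

Lemma quad_Aint (x : algC) (u v : int) :
  x ^+ 2 = u%:~R * x + v%:~R -> x \in Aint.
Proof.
move=> xE; pose p : {poly algC} := 'X^2 - (u%:~R *: 'X + (v%:~R)%:P).
have sz : (size (u%:~R *: 'X + (v%:~R)%:P : {poly algC})%R < 3)%N.
  rewrite (leq_ltn_trans (size_polyD _ _)) // gtn_max.
  by rewrite (leq_ltn_trans (size_scale_leq _ _)) ?size_polyX //
     (leq_ltn_trans (size_polyC_leq1 _)).
apply: (@root_monic_Aint p).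
- by rewrite /root /p !hornerE xE; apply/eqP; ring.
- by apply/monicP; rewrite /p lead_coefDl ?size_polyN ?size_polyXn // lead_coefXn.
- apply/polyOverP => i; rewrite /p !(coefB, coefD, coefZ, coefXn, coefX, coefC).
  apply: rpredB; first exact: rpred_nat.
  apply: rpredD; first by apply: rpredM; [exact: intr_int | exact: rpred_nat].
  by case: ifP => _; [exact: intr_int | exact: rpred0].
Qed.

Lemma OK_int (d k : int) : OK d k%:~R.
Proof. by split; [exact: inK_int | exact: Aint_int]. Qed.

Lemma OK1 (d : int) : OK d 1.
Proof. exact: (OK_int d 1). Qed.

Lemma OK0 (d : int) : OK d 0.
Proof. exact: (OK_int d 0). Qed.

Lemma OKD (d : int) (x y : algC) : OK d x -> OK d y -> OK d (x + y).
Proof. by move=> [xK xA] [yK yA]; split; [exact: inKD | exact: rpredD]. Qed.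

Lemma OKM (d : int) (x y : algC) : OK d x -> OK d y -> OK d (x * y).
Proof. by move=> [xK xA] [yK yA]; split; [exact: inKM | exact: rpredM]. Qed.

Lemma OKN (d : int) (x : algC) : OK d x -> OK d (- x).
Proof. by rewrite -mulN1r; apply: OKM; apply: (OK_int d (-1)). Qed.

Lemma OKB (d : int) (x y : algC) : OK d x -> OK d y -> OK d (x - y).
Proof. by move=> xO yO; apply: OKD => //; apply: OKN. Qed.

Lemma OK_conj (d : int) (x : algC) : d < 0 -> OK d x -> OK d x^*.
Proof. by move=> d0 [xK xA]; split; [exact: inK_conj | rewrite Aint_aut]. Qed.

Lemma fund_disc_mod4 (d : int) :
  fund_disc d -> exists k, d = 4 * k \/ d = 4 * k + 1.
Proof.
case=> [[d1 _]|[m [-> _]]]; last by exists m; left.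
by exists (d %/ 4)%Z; right; rewrite {1}(divz_eq d 4) d1; ring.
Qed.

(** Together with 1 it generates O_K over Z, uniformly in both cases of [fund_disc]. *)
Definition theta (d : int) : algC := (d%:~R + sqd d) / 2.

Lemma OK_theta (d : int) : fund_disc d -> OK d (theta d).
Proof.
move=> fd; split.
  rewrite /theta; apply: inKM.
    by apply: inKD; [exact: inK_int | exact: inK_sqd].
  by have := inK_rat d (2^-1); rewrite fmorphV /= ratr_nat.
have S2 := sqr_sqd d.
(* [theta d] is a root of X^2 - dX - (d - d^2)/4, which has integer coefficients because d is 0 or 1
   modulo 4. *)
have [k kE] : exists k, d - d ^+ 2 = 4 * k.
  have [k [->|->]] := fund_disc_mod4 d fd.
    by exists (k - 4 * k ^+ 2); ring.
  by exists (- k - 4 * k ^+ 2); ring.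
apply: (quad_Aint _ d k).
have kE' : d%:~R - d%:~R ^+ 2 = 4 * k%:~R :> algC.
  by rewrite -rmorphXn -rmorphB kE rmorphM.
have -> : k%:~R = (d%:~R - d%:~R ^+ 2) / 4 :> algC by rewrite kE'; field.
by rewrite /theta; field: S2.
Qed.

(** For x = a + b sqrt d the trace 2a and the norm a^2 - d b^2 are integers; squarefreeness bounds
    the denominator of b, and the norm equation modulo 4 settles the parities. *)
Lemma OKP (d : int) (x : algC) : fund_disc d -> d < 0 ->
  OK d x <-> exists u v : int, x = u%:~R + v%:~R * theta d.
Proof.
move=> fd d0; split; last first.
  by move=> [u [v ->]]; apply: OKD; [|apply: OKM; last exact: OK_theta]; exact: OK_int.
move=> [[a [b xE]] xA].
have xcE : x^* = ratr a - ratr b * sqd d.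
  by rewrite xE conjC_ratr_sqd.
have xcA : x^* \in Aint by rewrite Aint_aut.
have [u uE] : exists u : int, 2 * a = u%:~R.
  apply: ratr_Aint; have -> : ratr (2 * a) = x + x^*.
    by rewrite xcE xE; ring.
  exact: rpredD.
have [n nE] : exists n : int, a ^+ 2 - b ^+ 2 * d%:~R = n%:~R.
  apply: ratr_Aint; have -> : ratr (a ^+ 2 - b ^+ 2 * d%:~R) = x * x^*.
    by rewrite xcE xE ratr_sqd_norm.
  exact: rpredM.
have aE : a = u%:~R / 2 by rewrite -uE; field.
(* With 2a = u and 2b = v, the equation x = w + v theta amounts to u = v d + 2 w. *)
suff [v [w [vE uvw]]] : exists v w : int, 2 * b = v%:~R /\ u = v * d + 2 * w.
  exists w, v; rewrite xE aE uvw.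
  have -> : b = v%:~R / 2 by rewrite -vE; field.
  by rewrite /theta; field.
case: fd => [[d1 dsf]|[m [dE [m23 msf]]]].
  have [v vE] : exists v : int, 2 * b = v%:~R.
    apply: (sqfree_rat_int d (u ^+ 2 - 4 * n)) => //.
    by ring: (esym nE) (esym uE).
  have : u ^+ 2 - 4 * n = v ^+ 2 * d.
    apply: (@intr_inj rat).
    by ring: (esym nE) (esym uE) (esym vE).
  move=> uv; exists v.
  have [k dE] : exists k, d = 4 * k + 1.
    by exists (d %/ 4)%Z; rewrite {1}(divz_eq d 4) d1; ring.
  have [U [e [uU e01]]] : exists U e, u = 2 * U + e /\ (e = 0 \/ e = 1).
    by exists (u %/ 2)%Z, (u %% 2)%Z; lia.
  have [V [f [vV f01]]] : exists V f, v = 2 * V + f /\ (f = 0 \/ f = 1).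
    by exists (v %/ 2)%Z, (v %% 2)%Z; lia.
  (* Modulo 4 the equation u^2 - 4n = v^2 d reads u^2 = v^2, so u and v have the same parity. *)
  have ef : e = f.
    move: uv; rewrite uU vV dE.
    by case: e01 => ->; case: f01 => -> //; nia.
  by exists (U - V - 4 * V * k - 2 * f * k); split => //; rewrite uU vV dE ef; ring.
have [w wE] : exists w : int, 4 * b = w%:~R.
  apply: (sqfree_rat_int m (u ^+ 2 - 4 * n)) => //.
  by rewrite dE in nE; ring: (esym nE) (esym uE).
have uw : u ^+ 2 - 4 * n = w ^+ 2 * m.
  apply: (@intr_inj rat).
  by rewrite dE in nE; ring: (esym nE) (esym uE) (esym wE).
(* As m is 2 or 3 modulo 4, the congruence u^2 = w^2 m modulo 4 forces u and w to be even. *)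
have [k [l [wk ul]]] : exists k l, w = 2 * k /\ u = 2 * l.
  have [r [q [mq r23]]] : exists r q : int, m = 4 * q + r /\ (r = 2 \/ r = 3).
    by exists (m %% 4)%Z, (m %/ 4)%Z; split => //; lia.
  have [U [e [uU e01]]] : exists U e, u = 2 * U + e /\ (e = 0 \/ e = 1).
    by exists (u %/ 2)%Z, (u %% 2)%Z; lia.
  have [W [f [wW f01]]] : exists W f, w = 2 * W + f /\ (f = 0 \/ f = 1).
    by exists (w %/ 2)%Z, (w %% 2)%Z; lia.
  exists W, U; suff [e0 f0] : e = 0 /\ f = 0 by rewrite wW uU e0 f0 !addr0.
  move: uw; rewrite uU wW mq.
  by case: e01 => ->; case: f01 => -> //; case: r23 => -> uw; exfalso; nia.
exists k, (l - 2 * k * m); split; last by rewrite ul dE; ring.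
apply: (@mulfI _ 2) => //; rewrite mulrA -[2 * 2]/(4 : rat) wE wk rmorphM //=.
Qed.

(** * Fractional ideals as sets *)

(** Multiplication by a principal ideal is such a dilation ([mulI_pid]), which avoids the finite
    sums of [mulI]. *)
Definition scal (nu : algC) (I : cset) : cset := fun x => exists y, I y /\ x = nu * y.

Lemma pidE (d : int) (nu : algC) : pid d nu = scal nu (OK d).
Proof. by []. Qed.

Lemma scal1 (I : cset) : scal 1 I = I.
Proof.
apply: cset_eq => x; split=> [[y [Iy ->]]|Ix]; first by rewrite mul1r.
by exists x; rewrite mul1r.
Qed.

Lemma scalM (mu nu : algC) (I : cset) : scal mu (scal nu I) = scal (mu * nu) I.
Proof.
apply: cset_eq => x; split=> [[_ [[y [Iy ->]] ->]]|[y [Iy ->]]].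
  by exists y; rewrite mulrA.
by exists (nu * y); rewrite mulrA; split=> //; exists y.
Qed.

Lemma mulIC (I J : cset) : mulI I J = mulI J I.
Proof.
suff sub (A B : cset) x : mulI A B x -> mulI B A x by apply: cset_eq; split; apply: sub.
move=> [s [sAB ->]]; exists [seq (p.2, p.1) | p <- s]; split.
  by move=> _ /mapP[p /sAB[Ap Bp] ->].
by rewrite big_map; apply: eq_bigr => p _; rewrite mulrC.
Qed.

Definition omod (d : int) (I : cset) : Prop :=
  [/\ I 0, forall x y, I x -> I y -> I (x + y) & forall r x, OK d r -> I x -> I (r * x)].

Lemma is_frac_omod (d : int) (I : cset) : is_frac d I -> omod d I.
Proof. by move=> [_ [? [? [? _]]]]. Qed.

Lemma omod_OK (d : int) : omod d (OK d).
Proof. by split; [exact: OK0 | exact: OKD | move=> r x rO xO; apply: OKM]. Qed.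

Lemma omod_scal (d : int) (nu : algC) (I : cset) : omod d I -> omod d (scal nu I).
Proof.
move=> [I0 ID IM]; split; first by exists 0; rewrite mulr0.
  move=> _ _ [y [Iy ->]] [z [Iz ->]]; exists (y + z); rewrite mulrDr.
  by split=> //; apply: ID.
by move=> r _ rO [y [Iy ->]]; exists (r * y); split; [exact: IM | ring].
Qed.

Lemma omodZ (d : int) (I : cset) (m n : int) (x y : algC) :
  omod d I -> I x -> I y -> I (m%:~R * x + n%:~R * y).
Proof.
by move=> [_ ID IM] Ix Iy; apply: ID; apply: IM => //; apply: OK_int.
Qed.

Lemma mulI_sub (d : int) (I B : cset) (x : algC) :
  omod d I -> (forall b, B b -> OK d b) -> mulI I B x -> I x.
Proof.
move=> [I0 ID IM] BO [s [sIB ->]]; rewrite big_seq.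
elim/big_ind: _ => [//|//|p /sIB[Ip Bp]].
by rewrite mulrC; apply: IM => //; apply: BO.
Qed.

Lemma mem_mulI (I J : cset) (x y : algC) : I x -> J y -> mulI I J (x * y).
Proof.
move=> Ix Jy; exists [:: (x, y)]; split; last by rewrite big_seq1.
by move=> p; rewrite inE => /eqP->.
Qed.

Lemma mulI_pid (d : int) (nu : algC) (I : cset) :
  omod d I -> mulI (pid d nu) I = scal nu I.
Proof.
move=> mI; have [I0 ID IM] := mI; apply: cset_eq => x.
split=> [[s [sI ->]]|[y [Iy ->]]]; last first.
  by apply: mem_mulI => //; exists 1; rewrite mulr1; split=> //; apply: OK1.
have [S0 SD _] := omod_scal d nu I mI.
rewrite big_seq; elim/big_ind: _ => [//|//|p /sI[[z [Oz ->]] Ip]].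
by exists (z * p.2); rewrite mulrA; split=> //; apply: IM.
Qed.

Lemma mul_pid (d : int) (mu nu : algC) : mulI (pid d mu) (pid d nu) = pid d (mu * nu).
Proof.
by rewrite mulI_pid ?[pid d nu]pidE ?scalM //; apply/omod_scal/omod_OK.
Qed.

Lemma is_frac_scal (d : int) (nu : algC) (I : cset) :
  OK d nu -> nu != 0 -> is_frac d I -> is_frac d (scal nu I).
Proof.
move=> nuO nu0 [IK [I0 [ID [IM [[x [Ix x0]] [c [cO c0 cI]]]]]]].
split; first by move=> _ [y [/IK yK ->]]; apply: inKM => //; case: nuO.
split; first by exists 0; rewrite mulr0.
split.
  move=> _ _ [y [Iy ->]] [z [Iz ->]]; exists (y + z); rewrite mulrDr.
  by split=> //; apply: ID.
split; first by move=> r _ rO [y [Iy ->]]; exists (r * y); split; [exact: IM | ring].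
split; first by exists (nu * x); split; [exists x | rewrite mulf_neq0].
exists c; split=> // _ [y [/cI cyO ->]].
by rewrite mulrCA; apply: OKM.
Qed.

Lemma is_frac_OK (d : int) : is_frac d (OK d).
Proof.
split; first by move=> x [].
split; first exact: OK0.
split; first exact: OKD.
split; first by move=> r x rO xO; apply: OKM.
split; first by exists 1; split; [exact: OK1 | exact: oner_neq0].
by exists 1; split=> [||x]; [exact: OK1 | exact: oner_neq0 | rewrite mul1r].
Qed.


(** * Forms and their lattices *)

(** Forms are constructed with this predicate first; primitivity is recovered in [posdef_inQ] from
    [d] being fundamental. *)
Definition posdef (d : int) (Q : Defs.form) : Prop :=
  0 < fa Q /\ fb Q ^+ 2 - 4 * fa Q * fc Q = d.

Lemma inQ_posdef (d : int) (Q : Defs.form) : inQ d Q -> posdef d Q.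
Proof. by case. Qed.

Lemma posdef_fa_neq0 (d : int) (Q : Defs.form) : posdef d Q -> (fa Q)%:~R != 0 :> algC.
Proof. by case=> a0 _; rewrite intr_eq0 gt_eqF. Qed.

Lemma posdef_sqr_sqd (d : int) (Q : Defs.form) : posdef d Q ->
  sqd d ^+ 2 = (fb Q)%:~R ^+ 2 - 4 * (fa Q)%:~R * (fc Q)%:~R.
Proof. by case=> _ dE; rewrite sqr_sqd -[in LHS]dE; ring. Qed.

Lemma omega_root (d : int) (Q : Defs.form) : posdef d Q ->
  (fa Q)%:~R * omega d Q * omega d Q = - (fb Q)%:~R * omega d Q - (fc Q)%:~R.
Proof.
move=> pQ; have S2 := posdef_sqr_sqd d Q pQ; have a0 := posdef_fa_neq0 d Q pQ.
by rewrite /omega; field: S2.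
Qed.

Lemma omega_indep (d : int) (Q : Defs.form) (m n : int) : d < 0 -> posdef d Q ->
  m%:~R * omega d Q + n%:~R = 0 -> m = 0 /\ n = 0.
Proof.
move=> d0 pQ e; have a0 := posdef_fa_neq0 d Q pQ; have [apos _] := pQ.
have : (2 * n * fa Q - m * fb Q)%:~R + m%:~R * sqd d = 0.
  have -> : (2 * n * fa Q - m * fb Q)%:~R + m%:~R * sqd d
    = 2 * (fa Q)%:~R * (m%:~R * omega d Q + n%:~R) by rewrite /omega; field.
  by rewrite e mulr0.
move=> /intr_sqd_eq0 -/(_ d0) [e1 m0]; split=> //; move: e1; rewrite m0; nia.
Qed.

(** The difference is (b + d)/2, and b and d have the same parity since d = b^2 - 4ac. Hence 1 and a
    omega_Q also form a basis of O_K when d is fundamental. *)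
Lemma omega_theta (d : int) (Q : Defs.form) : posdef d Q ->
  exists e : int, (fa Q)%:~R * omega d Q = theta d - e%:~R.
Proof.
move=> pQ; have a0 := posdef_fa_neq0 d Q pQ.
have [e eE] : exists e, fb Q + d = 2 * e.
  case: pQ => _ <-; move: (fa Q) (fb Q) (fc Q) => a b c.
  have [b'|b'] : b = 2 * (b %/ 2)%Z \/ b = 2 * (b %/ 2)%Z + 1 by lia.
    by exists ((b %/ 2)%Z + 2 * (b %/ 2)%Z ^+ 2 - 2 * a * c); rewrite {1 2}b'; ring.
  exists (3 * (b %/ 2)%Z + 1 + 2 * (b %/ 2)%Z ^+ 2 - 2 * a * c); rewrite {1 2}b'; ring.
exists e; have eE' : e%:~R = ((fb Q)%:~R + d%:~R) / 2 :> algC.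
  by rewrite -rmorphD /= eE rmorphM /=; field.
by rewrite eE' /omega /theta; field.
Qed.

Lemma OK_omega (d : int) (Q : Defs.form) (x : algC) : fund_disc d -> d < 0 -> posdef d Q ->
  OK d x <-> exists u v : int, x = u%:~R + v%:~R * ((fa Q)%:~R * omega d Q).
Proof.
move=> fd d0 pQ; have [e ->] := omega_theta d Q pQ; rewrite OKP //.
split=> [[u [v ->]]|[u [v ->]]].
  by exists (u + v * e), v; ring.
by exists (u - v * e), v; ring.
Qed.

Lemma inK_omega (d : int) (Q : Defs.form) : inK d (omega d Q).
Proof.
have -> : omega d Q = ((- fb Q)%:~R + sqd d) * ratr (2 * (fa Q)%:~R)^-1.
  by rewrite /omega fmorphV rmorphM /= ratr_nat ratr_int rmorphN.
apply: inKM; last exact: inK_rat.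
by apply: inKD; [exact: inK_int | exact: inK_sqd].
Qed.

Lemma lat1 (w : algC) : lat w 1.
Proof. by exists 0, 1; rewrite mul0r add0r. Qed.

Lemma lat_gen (w : algC) : lat w w.
Proof. by exists 1, 0; rewrite mul1r addr0. Qed.

Lemma omod_lat (d : int) (Q : Defs.form) :
  fund_disc d -> d < 0 -> posdef d Q -> omod d (lat (omega d Q)).
Proof.
move=> fd d0 pQ; split; first by exists 0, 0; rewrite mul0r add0r.
  by move=> _ _ [m [n ->]] [p [q ->]]; exists (m + p), (n + q); ring.
move=> r _ /(OK_omega d Q r fd d0 pQ)[u [v ->]] [m [n ->]].
(* These are the coordinates of (u + v a w)(m w + n) after a w^2 is replaced by - b w - c. *)
exists (u * m + v * n * fa Q - v * m * fb Q), (u * n - v * m * fc Q).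
have r2 := omega_root d Q pQ; move: (omega d Q) r2 => w r2.
transitivity ((u * m + v * n * fa Q)%:~R * w + (u * n)%:~R
  + (v * m)%:~R * ((fa Q)%:~R * w * w)); first by ring.
by rewrite r2; ring.
Qed.

Lemma is_frac_lat (d : int) (Q : Defs.form) :
  fund_disc d -> d < 0 -> posdef d Q -> is_frac d (lat (omega d Q)).
Proof.
move=> fd d0 pQ; have [L0 LD LM] := omod_lat d Q fd d0 pQ.
split.
  move=> _ [m [n ->]]; apply: inKD; last exact: inK_int.
  by apply: inKM; [exact: inK_int | exact: inK_omega].
do 3![split=> //]; split; first by exists 1; split; [exact: lat1 | exact: oner_neq0].
exists (fa Q)%:~R; split; [exact: OK_int | exact: posdef_fa_neq0 pQ|].
move=> _ [m [n ->]]; apply/(OK_omega d Q) => //.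
by exists (fa Q * n), m; ring.
Qed.

Lemma is_frac_pid (d : int) (nu : algC) : OK d nu -> nu != 0 -> is_frac d (pid d nu).
Proof. by move=> nuO nu0; apply: is_frac_scal => //; apply: is_frac_OK. Qed.

Lemma int_coprime_pid (d : int) (N : nat) (nu : algC) :
  OK d nu -> nu != 0 -> (exists k, OK d k /\ nu = 1 + N%:R * k) ->
  int_coprime d N (pid d nu).
Proof.
move=> nuO nu0 [k [kO nuE]]; split; first exact: is_frac_pid.
  by move=> _ [y [yO ->]]; apply: OKM.
exists nu, (- k); split; [|exact: OKN|by rewrite nuE; ring].
by exists 1; rewrite mulr1; split=> //; apply: OK1.
Qed.

(** With A = a[omega_Q, 1] and B = a O_K, both are integral and contain a v = 1 - N u, where u and v
    are Bezout coefficients of N and a. *)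
Lemma IK_lat (d : int) (N : nat) (Q : Defs.form) :
  fund_disc d -> d < 0 -> inQN d N Q -> IK d N (lat (omega d Q)).
Proof.
move=> fd d0 [iQ cop]; have pQ := inQ_posdef d Q iQ; have a0 := posdef_fa_neq0 d Q pQ.
have fL := is_frac_lat d Q fd d0 pQ; split=> //.
have aO := OK_int d (fa Q).
have [u [v uvE]] := Bezoutz N%:Z (fa Q).
have uvE' : v%:~R * (fa Q)%:~R = 1 - N%:R * u%:~R :> algC.
  have e : (u * N%:Z + v * fa Q)%:~R = 1 :> algC by rewrite uvE cop.
  by apply: (@addIr _ (N%:R * u%:~R)); rewrite subrK -[RHS]e; ring.
exists (scal (fa Q)%:~R (lat (omega d Q))), (pid d (fa Q)%:~R); split.
- split; first exact: is_frac_scal.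
    move=> _ [_ [[m [n ->]] ->]]; apply/(OK_omega d Q) => //.
    by exists (fa Q * n), m; ring.
  exists ((fa Q)%:~R * v%:~R), u%:~R; split; [|exact: OK_int|by rewrite mulrC uvE'; ring].
  by exists v%:~R; split=> //; exists 0, v; rewrite mul0r add0r.
- split; first exact: is_frac_pid.
    by move=> _ [y [yO ->]]; apply: OKM.
  exists ((fa Q)%:~R * v%:~R), u%:~R; split; [|exact: OK_int|by rewrite mulrC uvE'; ring].
  by exists v%:~R; split=> //; apply: OK_int.
- by rewrite mulIC mulI_pid //; apply: is_frac_omod.
Qed.

(** * The action of SL2(Z) *)

Lemma mul2E (g h : 'M[int]_2) (i j : 'I_2) :
  (g *m h) i j = g i 0 * h 0 j + g i 1 * h 1 j.
Proof.
rewrite mxE !big_ord_recl big_ord0 addr0.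
by have -> : lift ord0 ord0 = 1 :> 'I_2 by apply: val_inj.
Qed.

Lemma eq_mx2 (g h : 'M[int]_2) :
  g 0 0 = h 0 0 -> g 0 1 = h 0 1 -> g 1 0 = h 1 0 -> g 1 1 = h 1 1 -> g = h.
Proof.
move=> e00 e01 e10 e11; apply/matrixP => i j.
have ordE (k : 'I_2) : k = 0 \/ k = 1.
  by case: k => [[|[|k]] lk] //; [left | right]; apply: val_inj.
by case: (ordE i) => ->; case: (ordE j) => ->.
Qed.

Lemma det2E (g : 'M[int]_2) : \det g = g 0 0 * g 1 1 - g 0 1 * g 1 0.
Proof.
rewrite (expand_det_row _ 0) !big_ord_recl big_ord0 /cofactor !det_mx11 !mxE /=.
rewrite expr0 mul1r addr0 expr1 mulN1r mulrN.
by congr (_ * g _ _ - g _ _ * g _ _); apply: val_inj.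
Qed.

Lemma SL2_det_algC (g : 'M[int]_2) : SL2 g ->
  (g 0 0)%:~R * (g 1 1)%:~R = 1 + (g 0 1)%:~R * (g 1 0)%:~R :> algC.
Proof.
rewrite /SL2 det2E => dg; have {}dg : g 0 0 * g 1 1 = 1 + g 0 1 * g 1 0 by lia.
by rewrite -rmorphM /= dg; ring.
Qed.

Definition mat2 (p q r s : int) : 'M[int]_2 :=
  \matrix_(i, j) if i == 0 then (if j == 0 then p else q) else (if j == 0 then r else s).

Lemma SL2_unit (g : 'M[int]_2) : SL2 g -> g \in unitmx.
Proof. by rewrite unitmxE => ->; apply: unitr1. Qed.

Lemma SL2M (g h : 'M[int]_2) : SL2 g -> SL2 h -> SL2 (g *m h).
Proof. by rewrite /SL2 det_mulmx => -> ->. Qed.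

Lemma SL2V (g : 'M[int]_2) : SL2 g -> SL2 (invmx g).
Proof. by rewrite /SL2 det_inv => ->; rewrite invr1. Qed.

Lemma SL2_inv (g : 'M[int]_2) :
  SL2 g -> invmx g = mat2 (g 1 1) (- g 0 1) (- g 1 0) (g 0 0).
Proof.
move=> Sg; have := Sg; rewrite /SL2 det2E => dg.
have Vg : g *m mat2 (g 1 1) (- g 0 1) (- g 1 0) (g 0 0) = 1%:M.
  apply: eq_mx2; rewrite mul2E !mxE /=; try by ring.
  - by rewrite -[RHS]dg; ring.
  - by rewrite -[RHS]dg; ring.
by rewrite -[LHS]mulmx1 -Vg mulmxA mulVmx ?mul1mx // SL2_unit.
Qed.

Lemma fact_form1 (Q : Defs.form) : fact_form Q 1%:M = Q.
Proof.
by case: Q => [[a b] c]; rewrite /fact_form /fa /fb /fc !mxE /=; congr (_, _, _); ring.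
Qed.

Lemma fact_formM (Q : Defs.form) (g h : 'M[int]_2) :
  fact_form (fact_form Q g) h = fact_form Q (g *m h).
Proof.
case: Q => [[a b] c]; rewrite /fact_form /fa /fb /fc !mul2E /=.
by congr (_, _, _); ring.
Qed.

Lemma posdef_fact (d : int) (Q : Defs.form) (g : 'M[int]_2) :
  d < 0 -> SL2 g -> posdef d Q -> posdef d (fact_form Q g).
Proof.
move=> d0; rewrite /SL2 det2E; case: Q => [[a b] c] dg [a0 dE].
rewrite /fact_form /posdef /fa /fb /fc /= in a0 dE *.
move: (g 0 0) (g 0 1) (g 1 0) (g 1 1) dg => p q r s dg; split; last first.
  transitivity ((b ^+ 2 - 4 * a * c) * (p * s - q * r) ^+ 2); first by ring.
  by rewrite dg dE expr1n mulr1.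
(* The new leading coefficient is Q(p, r), and 4a Q(p, r) = (2ap + br)^2 - d r^2 is a sum of
   nonnegative terms, not both zero because (p, r) is a column of a matrix of determinant 1. *)
suff : 0 < 4 * a * (a * p ^+ 2 + b * p * r + c * r ^+ 2) by rewrite pmulr_rgt0 // mulr_gt0.
have -> : 4 * a * (a * p ^+ 2 + b * p * r + c * r ^+ 2)
  = (2 * a * p + b * r) ^+ 2 + r ^+ 2 * (- d) by rewrite -dE; ring.
have [r0|r0] := eqVneq r 0.
  rewrite r0 mulr0 addr0 expr0n mul0r addr0 exprn_even_gt0 //= mulf_neq0 //.
    by rewrite mulf_neq0 // gt_eqF.
  by apply/eqP => p0; move: dg; rewrite r0 p0; lia.
by rewrite ltr_wpDl ?sqr_ge0 // mulr_gt0 ?oppr_gt0 // exprn_even_gt0.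
Qed.

Lemma jfac_neq0 (d : int) (Q : Defs.form) (g : 'M[int]_2) :
  d < 0 -> posdef d Q -> SL2 g -> jfac g (omega d Q) != 0.
Proof.
move=> d0 pQ; rewrite /SL2 det2E => dg; apply/eqP => /(omega_indep d Q _ _ d0 pQ)[r0 s0].
by move: dg; rewrite r0 s0; lia.
Qed.

(** The right action on forms becomes the left action on roots, whence the inverse; determinant 1
    keeps the sign of sqrt d. *)
Lemma mobius_omega (d : int) (Q : Defs.form) (g : 'M[int]_2) :
  d < 0 -> posdef d Q -> SL2 g ->
  mobius g (omega d Q) = omega d (fact_form Q (invmx g)).
Proof.
move=> d0 pQ Sg; have j0 := jfac_neq0 d Q g d0 pQ Sg.
have pQ' := posdef_fact d Q _ d0 (SL2V g Sg) pQ.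
have a0' := posdef_fa_neq0 d _ pQ'; have a0 := posdef_fa_neq0 d _ pQ.
have S2 := posdef_sqr_sqd d Q pQ.
have dg := SL2_det_algC g Sg.
rewrite /mobius; apply: (canLR (mulfK j0)).
move: a0' a0 S2; rewrite /omega /jfac SL2_inv // /fact_form !mxE /=.
case: Q {pQ pQ' j0} => [[a b] c]; rewrite /fa /fb /fc /=.
move: dg; move: (g 0 0) (g 0 1) (g 1 0) (g 1 1) => p q r s dg a0' a0 S2.
field: S2 dg; rewrite a0 /=; apply: contraNneq a0' => e; apply/eqP.
by rewrite -[RHS]e; ring.
Qed.

(** Comparing coefficients of 1 and sqrt d gives equal a and b; the discriminant then gives c. *)
Lemma omega_inj (d : int) (Q Q' : Defs.form) : d < 0 -> posdef d Q -> posdef d Q' ->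
  omega d Q = omega d Q' -> Q = Q'.
Proof.
move=> d0 pQ pQ' e; have a0 := posdef_fa_neq0 d Q pQ; have a0' := posdef_fa_neq0 d Q' pQ'.
have : (fa Q * fb Q' - fa Q' * fb Q)%:~R + (fa Q' - fa Q)%:~R * sqd d = 0.
  transitivity (2 * (fa Q)%:~R * (fa Q')%:~R * (omega d Q - omega d Q')).
    by rewrite /omega; field; apply/andP.
  by rewrite e subrr mulr0.
move=> /intr_sqd_eq0 -/(_ d0)[e1 e2].
case: pQ pQ' {e a0 a0'} => aQ dQ [aQ' dQ'].
case: Q Q' aQ dQ aQ' dQ' e1 e2 => [[a b] c] [[a' b'] c']; rewrite /fa /fb /fc /=.
move=> aQ dQ aQ' dQ' e1 e2; have aE : a' = a by lia.
have bE : b' = b by subst a'; nia.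
have cE : c' = c by subst a' b'; nia.
by rewrite aE bE cE.
Qed.

(** For g = [p q; r s], the numbers j g(omega) = p omega + q and j = r omega + s form another
    Z-basis of the lattice of omega. *)
Lemma lat_mobius (d : int) (Q : Defs.form) (g : 'M[int]_2) :
  d < 0 -> posdef d Q -> SL2 g ->
  lat (omega d Q) = scal (jfac g (omega d Q)) (lat (mobius g (omega d Q))).
Proof.
move=> d0 pQ Sg; have j0 := jfac_neq0 d Q g d0 pQ Sg.
have jm : jfac g (omega d Q) * mobius g (omega d Q)
    = (g 0 0)%:~R * omega d Q + (g 0 1)%:~R by rewrite mulrCA mulfV ?mulr1.
apply: cset_eq => x; split=> [[m [n ->]]|[_ [[m [n ->]] ->]]].
  exists ((m * g 1 1 - n * g 1 0)%:~R * mobius g (omega d Q)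
          + (n * g 0 0 - m * g 0 1)%:~R); split.
    by exists (m * g 1 1 - n * g 1 0), (n * g 0 0 - m * g 0 1).
  rewrite mulrDr (mulrCA (jfac _ _)) jm /jfac.
  by have dg := SL2_det_algC g Sg; ring: dg.
exists (m * g 0 0 + n * g 1 0), (m * g 0 1 + n * g 1 1).
by rewrite mulrDr (mulrCA (jfac _ _)) jm /jfac; ring.
Qed.

(** * Homothetic lattices *)

Lemma conjC_int (m : int) : (m%:~R : algC)^* = m%:~R.
Proof. by rewrite conj_intr ?intr_int. Qed.

Lemma conj_omega (d : int) (Q : Defs.form) : d < 0 ->
  (omega d Q)^* = (- (fb Q)%:~R - sqd d) / (2 * (fa Q)%:~R).
Proof.
move=> d0; rewrite /omega fmorph_div rmorphD /= conj_sqd // rmorphN rmorphM /=.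
by rewrite !conjC_int conjC_nat.
Qed.

(** Converse of [lat_mobius]. The coordinates of omega' and 1 in the basis (nu omega, nu) form a
    matrix; those of nu omega and nu in (omega', 1) form its inverse, so its determinant is a unit
    of Z. *)
Lemma lat_scal_mobius (d : int) (Q Q' : Defs.form) (nu : algC) :
  d < 0 -> posdef d Q -> posdef d Q' ->
  lat (omega d Q') = scal nu (lat (omega d Q)) ->
  exists g, [/\ SL2 g, mobius g (omega d Q) = omega d Q' & nu * jfac g (omega d Q) = 1].
Proof.
move=> d0 pQ pQ' e; set w := omega d Q in e *; set w' := omega d Q' in e *.
have [_ [[p [q ->]] w'E]] : scal nu (lat w) w' by rewrite -e; apply: lat_gen.
have [_ [[r [s ->]] oneE]] : scal nu (lat w) 1 by rewrite -e; apply: lat1.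
have [p' [q' wE]] : lat w' (nu * w) by rewrite e; exists w; split=> //; apply: lat_gen.
have [r' [s' nuE]] : lat w' nu by rewrite e; exists 1; rewrite mulr1; split=> //; apply: lat1.
have nu0 : nu != 0 by apply/eqP => nu0; move/eqP: oneE; rewrite nu0 mul0r oner_eq0.
set j := r%:~R * w + s%:~R in oneE.
have [e1 e2] : p' * p + q' * r - 1 = 0 /\ p' * q + q' * s = 0.
  apply: (omega_indep d Q) => //; apply: (mulfI nu0); rewrite mulr0 -/w.
  transitivity (p'%:~R * (nu * (p%:~R * w + q%:~R)) + q'%:~R * (nu * j) - nu * w).
    by rewrite /j; ring.
  by rewrite -w'E -oneE mulr1 wE subrr.
have [e3 e4] : r' * p + s' * r = 0 /\ r' * q + s' * s - 1 = 0.
  apply: (omega_indep d Q) => //; apply: (mulfI nu0); rewrite mulr0 -/w.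
  transitivity (r'%:~R * (nu * (p%:~R * w + q%:~R)) + s'%:~R * (nu * j) - nu).
    by rewrite /j; ring.
  by rewrite -w'E -oneE mulr1 -nuE subrr.
have j0 : j != 0 by apply/eqP => j0; move/eqP: oneE; rewrite j0 mulr0 oner_eq0.
have detE : (p * s - q * r) * (p' * s' - q' * r') = 1.
  transitivity ((p' * p + q' * r) * (r' * q + s' * s) - (p' * q + q' * s) * (r' * p + s' * r)).
    by ring.
  by rewrite e2 mul0r subr0 (subr0_eq e1) (subr0_eq e4) mulr1.
have a0 := posdef_fa_neq0 d Q pQ; have a0' := posdef_fa_neq0 d Q' pQ'.
have wj : w' * j = p%:~R * w + q%:~R.
  by apply: (mulfI nu0); rewrite -w'E mulrCA -oneE mulr1.
have wjc := congr1 (fun z : algC => z^*) wj.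
rewrite /= rmorphM [X in _ = X]rmorphD [X in _ = X + _]rmorphM /= !conjC_int in wjc.
have jc : j^* = r%:~R * w^* + s%:~R.
by rewrite /j rmorphD [X in X + _ = _]rmorphM /= !conjC_int.
(* Comparing imaginary parts of w' and (pw+q)/(rw+s) fixes the sign of the determinant. *)
have key : (fa Q)%:~R * (j * j^*) = (p * s - q * r)%:~R * (fa Q')%:~R.
  have S0 := sqd_neq0 d d0.
  have wS : w - w^* = sqd d / (fa Q)%:~R by rewrite /w conj_omega // /omega; field.
  have wS' : w' - w'^* = sqd d / (fa Q')%:~R by rewrite /w' conj_omega // /omega; field.
  have : (w' - w'^*) * (j * j^*) = (p * s - q * r)%:~R * (w - w^*).
    transitivity ((w' * j) * j^* - (w'^* * j^*) * j); first by ring.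
    by rewrite wj wjc jc /j; ring.
  rewrite wS wS' => E; apply: (mulfI S0).
  transitivity ((fa Q)%:~R * (fa Q')%:~R * (sqd d / (fa Q')%:~R * (j * j^*))); first by field.
  by rewrite E; field.
have det0 : 0 < p * s - q * r.
  case: pQ pQ' => aQ _ [aQ' _].
  have : 0 < (p * s - q * r)%:~R * (fa Q')%:~R :> algC.
    by rewrite -key mulr_gt0 ?ltr0z // mul_conjC_gt0.
  by rewrite pmulr_lgt0 ?ltr0z.
exists (mat2 p q r s); split.
- rewrite /SL2 det2E !mxE /=; move: detE det0 {key}.
  move: (p * s - q * r) (p' * s' - q' * r') => D E DE D0.
  have E0 : 0 < E by nia.
  by nia.
- by rewrite /mobius /jfac !mxE /= -/j -wj mulfK.
- by rewrite /jfac !mxE [RHS]oneE.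
Qed.

(** Multiplication by [u] acts on the basis (omega, 1) by an integer matrix, and [u] is a root of
    its characteristic polynomial. *)
Lemma scal_lat_OK (d : int) (Q : Defs.form) (u : algC) :
  d < 0 -> scal u (lat (omega d Q)) = lat (omega d Q) -> OK d u.
Proof.
move=> d0 e; set w := omega d Q in e *.
have [c [f uE]] : lat w (u * 1) by rewrite -e; exists 1; split=> //; apply: lat1.
have [a [b uwE]] : lat w (u * w) by rewrite -e; exists w; split=> //; apply: lat_gen.
rewrite mulr1 in uE; split.
  rewrite uE; apply: inKD; last exact: inK_int.
  by apply: inKM; [exact: inK_int | exact: inK_omega].
apply: (quad_Aint _ (a + f) (c * b - a * f)).
transitivity (c%:~R * (u * w) + f%:~R * u); first by rewrite expr2 {1}uE; ring.
by rewrite uwE uE; ring.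
Qed.

(** Both [u] and its inverse stabilise the lattice, so [u] is a unit of O_K. *)
Lemma scal_lat_pid (d : int) (Q : Defs.form) (u : algC) :
  d < 0 -> u != 0 -> scal u (lat (omega d Q)) = lat (omega d Q) -> pid d u = OK d.
Proof.
move=> d0 u0 e; have uO := scal_lat_OK d Q u d0 e.
have VuO : OK d u^-1.
  by apply: (scal_lat_OK d Q) => //; rewrite -[in LHS]e scalM mulVf // scal1.
apply: cset_eq => x; split=> [[y [yO ->]]|xO]; first exact: OKM.
by exists (u^-1 * x); rewrite mulrA mulfV // mul1r; split=> //; apply: OKM.
Qed.

(** * Surjectivity *)

(** The generator is the least positive element, found by classical descent because [S] is an
    arbitrary predicate; a nonzero remainder would be smaller. *)
Lemma int_subgroup_gen (S : int -> Prop) (x0 : int) :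
  (forall m n x y, S x -> S y -> S (m * x + n * y)) -> S x0 -> x0 != 0 ->
  exists2 g, 0 < g /\ S g & forall x, S x -> (g %| x)%Z.
Proof.
move=> SL Sx0 x00.
have min (k : nat) : (0 < k)%N -> S k%:Z ->
    exists2 g : nat, (0 < g)%N /\ S g%:Z & forall i : nat, (0 < i < g)%N -> ~ S i%:Z.
  elim/ltn_ind: k => k IH k0 Sk.
  case: (classic (exists2 i : nat, (0 < i < k)%N & S i%:Z)) => [[i /andP[i0 ik] Si]|no].
    exact: IH ik i0 Si.
  by exists k => // i ik Si; apply: no; exists i.
have Sabs : S `|x0|%N%:Z.
  have [x0E|x0E] : `|x0|%N%:Z = x0 \/ `|x0|%N%:Z = - x0 by lia.
    by rewrite x0E.
  by have := SL (-1) 0 x0 x0 Sx0 Sx0; rewrite x0E mul0r addr0 mulN1r.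
have [|g [g0 Sg] gmin] := min _ _ Sabs; first by lia.
exists g%:Z; first by split.
move=> x Sx; apply/dvdz_mod0P/eqP; apply: contraT => r0; exfalso.
have rE := divz_eq x g%:Z.
apply: (gmin `|x %% g%:Z|%Z%N); first by lia.
have -> : `|x %% g%:Z|%Z%N%:Z = 1 * x + (- (x %/ g%:Z)%Z) * g%:Z by lia.
exact: SL.
Qed.

Lemma dvdzB (p m n : int) : (p %| m)%Z -> (p %| n)%Z -> (p %| m - n)%Z.
Proof. by move=> /dvdzP[a ->] /dvdzP[b ->]; rewrite -mulrBl dvdz_mull. Qed.

(* t collects the primes dividing m + N s but not n, so that each prime divisor of
   m + N s divides exactly one of n and N t. *)
Lemma coprimez_translate (m n N : int) : N != 0 -> gcdz (gcdz m n) N = 1 ->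
  exists s t : int, coprimez (m + N * s) (n + N * t).
Proof.
move=> N0 cop.
(* A nonzero [m'] has only finitely many prime divisors, so [t] can be their product over those not
   dividing n. *)
have [s m0] : exists s : int, m + N * s != 0.
  have [->|m0] := eqVneq m 0; first by exists 1; rewrite add0r mulr1.
  by exists 0; rewrite mulr0 addr0.
set m' := m + N * s in m0.
pose t : nat := \prod_(p <- primes `|m'| | ~~ (p %| `|n|)%N) p.
exists s, t%:Z; set n' := n + N * t%:Z; rewrite -/m' coprimezE; apply: contraT => ncop.
pose p := pdiv (gcdn `|m'| `|n'|).
have gpos : (0 < gcdn `|m'| `|n'|)%N by rewrite gcdn_gt0 absz_gt0 m0.
have pp : prime p by apply: pdiv_prime; rewrite ltn_neqAle eq_sym ncop.
have pm : (p%:Z %| m')%Z.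
  by rewrite dvdzE; apply: dvdn_trans (pdiv_dvd _) (dvdn_gcdl _ _).
have pn : (p%:Z %| n')%Z.
  by rewrite dvdzE; apply: dvdn_trans (pdiv_dvd _) (dvdn_gcdr _ _).
have pprimes : p \in primes `|m'| by rewrite mem_primes pp absz_gt0 m0.
have ptE : (p %| t)%N = ~~ (p %| `|n|)%N.
  have [pn0|pn0] := boolP (p %| `|n|)%N; last by rewrite /t (big_rem p) //= pn0 dvdn_mulr.
  apply: negbTE; rewrite /t big_seq_cond.
  elim/big_ind: _ => [|x y px py|q /andP[]].
  - by rewrite dvdn1; apply: contraL pp => /eqP->.
  - by rewrite Euclid_dvdM // negb_or px.
  rewrite mem_primes => /andP[qp _]; apply: contra.
  by rewrite dvdn_prime2 // => /eqP<-.
have [pn0|pn0] := boolP (p %| `|n|)%N; last first.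
  have : (p%:Z %| n)%Z.
    by rewrite -[n](addrK (N * t%:Z)); apply: dvdzB => //; apply: dvdz_mull; rewrite dvdzE /= ptE.
  by rewrite dvdzE /= (negPf pn0).
(* Here p divides n and n + N t but not t, so it divides N and hence m, against the gcd
   hypothesis. *)
have pN : (p%:Z %| N)%Z.
  have : (p%:Z %| N * t%:Z)%Z by rewrite -[N * _](addKr n) addrC; apply: dvdzB; rewrite // dvdzE.
  by rewrite !dvdzE abszM Euclid_dvdM //= ptE pn0 orbF.
have pm0 : (p%:Z %| m)%Z.
  by rewrite -[m](addrK (N * s)); apply: dvdzB => //; apply: dvdz_mulr.
have : (p%:Z %| gcdz (gcdz m n) N)%Z by rewrite !dvdz_gcd pm0 pN dvdzE pn0.
rewrite cop.
by rewrite dvdzE /= dvdn1 => /eqP p1; move: pp; rewrite p1.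
Qed.

(** * Bases of fractional ideals, and forms attached to lattices *)

Lemma theta_indep (d m n : int) :
  d < 0 -> m%:~R + n%:~R * theta d = 0 -> m = 0 /\ n = 0.
Proof.
move=> d0 e; have : (2 * m + n * d)%:~R + n%:~R * sqd d = 0.
  by transitivity (2 * (m%:~R + n%:~R * theta d)); [rewrite /theta; field | rewrite e mulr0].
by move=> /intr_sqd_eq0 -/(_ d0) [e1 n0]; split=> //; move: e1; rewrite n0; lia.
Qed.

(** The norm lies in O_K and is fixed by conjugation, so its coordinate along theta vanishes. *)
Lemma OK_norm (d : int) (y : algC) : fund_disc d -> d < 0 ->
  OK d y -> exists k : int, y * y^* = k%:~R.
Proof.
move=> fd d0 yO; have yyO := OKM _ _ _ yO (OK_conj d y d0 yO).
have [u [v yyE]] := (OKP d _ fd d0).1 yyO.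
exists u; have S0 := sqd_neq0 d d0.
have : (y * y^*)^* = y * y^* by rewrite rmorphM /= conjCK mulrC.
rewrite yyE rmorphD [X in _ + X = _]rmorphM /= !conjC_int => e.
have thetaS : theta d - (theta d)^* = sqd d.
  by rewrite /theta fmorph_div rmorphD /= conjC_int conjC_nat conj_sqd //; field.
have : v%:~R * sqd d = 0.
  rewrite -thetaS.
  transitivity ((u%:~R + v%:~R * theta d) - (u%:~R + v%:~R * (theta d)^*)); first by ring.
  by rewrite e subrr.
by move=> /eqP; rewrite mulf_eq0 (negPf S0) orbF => /eqP->; rewrite mul0r addr0.
Qed.

(** Triangular basis of J = c I inside Z + Z theta: g0 generates the integers in J, g1 generates the
    theta-coordinates of J and is lifted to l + g1 theta. Dividing by c gives a basis of I. *)
Lemma is_frac_basis (d : int) (I : cset) : fund_disc d -> d < 0 -> is_frac d I ->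
  exists x1 x2, [/\ I x1, I x2,
    forall x, I x -> exists m n : int, x = m%:~R * x1 + n%:~R * x2 &
    forall m n : int, m%:~R * x1 + n%:~R * x2 = 0 -> m = 0 /\ n = 0].
Proof.
move=> fd d0 fI; have mI := is_frac_omod d I fI.
have [_ [_ [_ [_ [[x [Ix x0]] [c [cO c0 cI]]]]]]] := fI.
set J := scal c I; have mJ : omod d J by apply: omod_scal.
have [_ _ JM] := mJ.
have JO y : J y -> OK d y by move=> [z [/cI zO ->]].
have [y Jy y0] : exists2 y, J y & y != 0.
  by exists (c * x); [exists x | rewrite mulf_neq0].
(* The norm k of a nonzero element puts k and k theta in J, so both subgroups of Z are nonzero. *)
have [k kE] := OK_norm d y fd d0 (JO y Jy).
have k0 : k != 0 by rewrite -(intr_eq0 algC) -kE mulf_neq0 // conjC_eq0.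
have Jk : J k%:~R by rewrite -kE mulrC; apply: JM => //; apply: OK_conj => //; apply: JO.
have Jkt : J (k%:~R * theta d) by rewrite mulrC; apply: JM => //; apply: OK_theta.
pose S0 u := J u%:~R; pose S1 v := exists u : int, J (u%:~R + v%:~R * theta d).
have [|||g0 [g00 Jg0] g0min] := int_subgroup_gen S0 k => //.
  move=> m n a b Ja Jb; rewrite /S0.
  by have := omodZ d J m n _ _ mJ Ja Jb; rewrite -!rmorphM -rmorphD.
have [|||g1 [g10 [l Jg1]] g1min] := int_subgroup_gen S1 k => //.
- move=> m n a b [u Ja] [v Jb]; exists (m * u + n * v).
  by have := omodZ d J m n _ _ mJ Ja Jb; congr J; ring.
- by exists 0; rewrite add0r.
have [x1 [Ix1 x1E]] := Jg0; have [x2 [Ix2 x2E]] := Jg1.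
exists x1, x2; split=> // [z Iz|m n e].
  have Jz : J (c * z) by exists z.
  have [u [v uvE]] := (OKP d _ fd d0).1 (JO _ Jz).
  have /dvdzP[q vE] : (g1 %| v)%Z by apply: g1min; exists u; rewrite -uvE.
  have /dvdzP[q' uE] : (g0 %| u - q * l)%Z.
    apply: g0min; have := omodZ d J 1 (- q) _ _ mJ Jz Jg1.
    by rewrite uvE vE; congr J; ring.
  exists q', q; apply: (mulfI c0); rewrite uvE vE.
  transitivity (q'%:~R * (c * x1) + q%:~R * (c * x2)); last by ring.
  rewrite -x1E -x2E; have -> : u = q' * g0 + q * l by rewrite -uE subrK.
  by ring.
have : (m * g0 + n * l)%:~R + (n * g1)%:~R * theta d = 0.
  transitivity (c * (m%:~R * x1 + n%:~R * x2)); last by rewrite e mulr0.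
  transitivity (m%:~R * (c * x1) + n%:~R * (c * x2)); last by ring.
  by rewrite -x1E -x2E; ring.
move=> /theta_indep -/(_ d0) [e0 e1]; have n0 : n = 0 by nia.
by split=> //; move: e0; rewrite n0; nia.
Qed.

(** Stability under theta gives theta = a w + k and theta w = m w + n, hence w = (- b + sqrt d)/(2a)
    with b = 2k - d and b^2 + 4an = d. *)
Lemma omod_lat_form (d : int) (w : algC) : fund_disc d -> d < 0 ->
  omod d (lat w) -> exists2 Q, posdef d Q & lat (omega d Q) = lat w.
Proof.
move=> fd d0 [_ _ LM]; have tO := OK_theta d fd.
have [a [k tE]] : lat w (theta d) by rewrite -[theta d]mulr1; apply: LM => //; apply: lat1.
have [m [n twE]] : lat w (theta d * w) by apply: LM => //; apply: lat_gen.
have a0 : a != 0.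
  apply/eqP => a0; have : (- k)%:~R + 1%:~R * theta d = 0 by rewrite tE a0; ring.
  by move=> /theta_indep -/(_ d0) [].
have a0' : a%:~R != 0 :> algC by rewrite intr_eq0.
pose b := 2 * k - d.
have wE : w = (- b%:~R + sqd d) / (2 * a%:~R).
  have SE : sqd d = 2 * theta d - d%:~R by rewrite /theta; field.
  by rewrite SE tE /b; field.
have S2 := sqr_sqd d.
have [e1 e2] : d + b ^+ 2 + 2 * (m - k) * b - 4 * a * n = 0 /\ - 2 * b - 2 * (m - k) = 0.
  apply: (intr_sqd_eq0 d) => //.
  transitivity (4 * a%:~R * ((a%:~R * w + k%:~R) * w - (m%:~R * w + n%:~R))).
    by rewrite wE; field: S2.
  by rewrite -twE -tE subrr mulr0.
have disc : b ^+ 2 + 4 * a * n = d by nia.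
have [apos|aneg] : 0 < a \/ 0 < - a by lia.
  exists (a, b, - n); first by split=> //; rewrite -[RHS]disc /fa /fb /fc /=; ring.
  by rewrite /omega /fa /fb /= -wE.
(* For negative a the opposite root - w spans the same lattice and has leading coefficient - a. *)
exists (- a, b, n); first by split=> //; rewrite -[RHS]disc /fa /fb /fc /=; ring.
have -> : omega d (- a, b, n) = - w by rewrite /omega /fa /fb /= wE; field.
by apply: cset_eq => x; split=> [[i [j ->]]|[i [j ->]]]; exists (- i), j; ring.
Qed.

Lemma int_mul_eq1 (g v : int) : 0 <= g -> g * v = 1 -> g = 1.
Proof.
move=> g0 gv; have v0 : 0 < v by nia.
by nia.
Qed.

(* O_K = Z + Z a omega_Q, so a omega_Q is primitive in O_K. *)
Lemma OK_omega_multiple (d : int) (Q : Defs.form) (g : int) (z : algC) :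
  fund_disc d -> d < 0 -> posdef d Q -> 0 <= g -> OK d z ->
  (fa Q)%:~R * omega d Q = g%:~R * z -> g = 1.
Proof.
move=> fd d0 pQ g0 /(OK_omega d Q z fd d0 pQ)[u [v zE]] e.
have : (fa Q * (1 - g * v))%:~R * omega d Q + (- (g * u))%:~R = 0.
  transitivity ((fa Q)%:~R * omega d Q - g%:~R * z); first by rewrite zE; ring.
  by rewrite e subrr.
move=> /(omega_indep d Q _ _ d0 pQ)[/eqP]; rewrite mulf_eq0 (gt_eqF pQ.1) /=.
by rewrite subr_eq0 => /eqP/esym + _; apply: int_mul_eq1.
Qed.

Lemma posdef_inQ (d : int) (Q : Defs.form) : fund_disc d -> d < 0 -> posdef d Q -> inQ d Q.
Proof.
move=> fd d0 pQ; have [a0 dE] := pQ; split=> //.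
set g := gcdz _ _.
have /dvdzP[a' aE] : (g %| fa Q)%Z := dvdz_trans (dvdz_gcdl _ _) (dvdz_gcdl _ _).
have /dvdzP[b' bE] : (g %| fb Q)%Z := dvdz_trans (dvdz_gcdl _ _) (dvdz_gcdr _ _).
have /dvdzP[c' cE] : (g %| fc Q)%Z := dvdz_gcdr _ _.
have g0 : 0 < g.
  rewrite lt_neqAle; apply/andP; split; last by [].
  by apply/eqP => g0; move: a0; rewrite aE -g0 mulr0 ltxx.
have aw := omega_root d Q pQ.
(* If g divides a, b and c, then a omega_Q / g is still integral. *)
apply: (OK_omega_multiple d Q g (a'%:~R * omega d Q)) => //.
  split; first by apply: inKM; [exact: inK_int | exact: inK_omega].
  apply: (quad_Aint _ (- b') (- (a' * c'))).
  have g0' : g%:~R != 0 :> algC by rewrite intr_eq0 gt_eqF.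
  apply: (mulfI g0').
  transitivity (a'%:~R * ((a' * g)%:~R * omega d Q * omega d Q)); first by ring.
  by rewrite -aE aw bE cE; ring.
by rewrite {1}aE; ring.
Qed.

(** If g divides N = N' g and a = a' g, then a omega_Q = a omega_Q (al - N k) is g times the
    integral element a' al omega_Q - N' a omega_Q k, which forces g = 1. *)
Lemma gcdz_fa_eq1 (d : int) (N : nat) (Q : Defs.form) (al k : algC) :
  fund_disc d -> d < 0 -> posdef d Q -> OK d k -> al = 1 + N%:R * k ->
  OK d (al * omega d Q) -> gcdz N%:Z (fa Q) = 1.
Proof.
move=> fd d0 pQ kO alE awO; set g := gcdz _ _.
have /dvdzP[N' NE] : (g %| N%:Z)%Z := dvdz_gcdl _ _.
have /dvdzP[a' aE] : (g %| fa Q)%Z := dvdz_gcdr _ _.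
have NE' : N%:R = N'%:~R * g%:~R :> algC by rewrite -rmorphM -NE.
have waO : OK d ((fa Q)%:~R * omega d Q).
  by apply/(OK_omega d Q) => //; exists 0, 1; ring.
apply: (OK_omega_multiple d Q g
  (a'%:~R * (al * omega d Q) - N'%:~R * (((fa Q)%:~R * omega d Q) * k))) => //.
- by apply: OKB; apply: OKM; rewrite ?OK_int //; [exact: OK_int | exact: OK_int | exact: OKM].
- by rewrite alE NE' aE; ring.
Qed.

Lemma int_coprime_elt (d : int) (N : nat) (A : cset) : (0 < N)%N -> int_coprime d N A ->
  exists2 al, A al & al != 0 /\ exists2 k, OK d k & al = 1 + N%:R * k.
Proof.
move=> N0 [fA AO [a [b [Aa bO abE]]]].
have [_ [_ [AD [AM [[c [Ac c0]] _]]]]] := fA.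
have aE : a = 1 + N%:R * (- b) by rewrite -[a](addrK (N%:R * b)) abE; ring.
(* If a = 1 - N b vanishes, adding N times a nonzero element of A keeps the congruence. *)
have [a0|a0] := eqVneq a 0; last by exists a => //; split=> //; exists (- b) => //; exact: OKN.
exists (a + N%:R * c); first by apply: AD => //; apply: AM => //; apply: (OK_int d N).
split; first by rewrite a0 add0r mulf_neq0 // pnatr_eq0 -lt0n.
exists (- b + c); last by rewrite {1}aE; ring.
by apply: OKD; [exact: OKN | exact: AO].
Qed.

Lemma IK_form (d : int) (N : nat) (I : cset) :
  fund_disc d -> d < 0 -> (0 < N)%N -> IK d N I ->
  exists2 Q, inQN d N Q & exists nu, [/\ inK d nu, nu != 0, mcong1 d N nu &
    lat (omega d Q) = mulI (pid d nu) I].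
Proof.
move=> fd d0 N0 [fI [A [B [cA cB AE]]]]; have mI := is_frac_omod d I fI.
have [IK [_ [ID [IM _]]]] := fI.
have [al Aal [al0 [ka kaO alE]]] := int_coprime_elt d N A N0 cA.
have [be Bbe [be0 [kb kbO beE]]] := int_coprime_elt d N B N0 cB.
have [_ AO _] := cA; have [_ BO _] := cB.
have Ial : I al by apply: (mulI_sub d I B) => //; rewrite AE.
have beI x : I x -> OK d (be * x).
  by move=> Ix; apply: AO; rewrite -AE mulrC; apply: mem_mulI.
have NO : OK d N%:R := OK_int d N.
have [x1 [x2 [Ix1 Ix2 gen indep]]] := is_frac_basis d I fd d0 fI.
have [m [n alE']] := gen al Ial.
pose kc := ka + kb + N%:R * (ka * kb).
have kcO : OK d kc by apply: OKD; [exact: OKD | apply: OKM => //; exact: OKM].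
have bealE : be * al = 1 + N%:R * kc by rewrite alE beE /kc; ring.
(* A common divisor of m, n and N divides be al - N kc = 1 in O_K, because be I is integral. *)
have cop : gcdz (gcdz m n) N%:Z = 1.
  set g := gcdz _ _.
  have /dvdzP[m' mE] : (g %| m)%Z := dvdz_trans (dvdz_gcdl _ _) (dvdz_gcdl _ _).
  have /dvdzP[n' nE] : (g %| n)%Z := dvdz_trans (dvdz_gcdl _ _) (dvdz_gcdr _ _).
  have /dvdzP[N' NE] : (g %| N%:Z)%Z := dvdz_gcdr _ _.
  have NE' : N%:R = N'%:~R * g%:~R :> algC by rewrite -rmorphM -NE.
  pose z := be * (m'%:~R * x1 + n'%:~R * x2) - N'%:~R * kc.
  have zO : OK d z.
      apply: OKB; first by apply: beI; apply: (omodZ d).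
    by apply: OKM => //; exact: OK_int.
  have gz : g%:~R * z = 1.
    transitivity (be * al - N%:R * kc); last by rewrite bealE; ring.
    by rewrite /z alE' NE' mE nE; ring.
  have [i [j zE]] := (OKP d z fd d0).1 zO.
  have [e1 _] : g * i - 1 = 0 /\ g * j = 0.
    apply: (theta_indep d) => //.
    by transitivity (g%:~R * z - 1); [rewrite zE; ring | rewrite gz subrr].
  by apply: (int_mul_eq1 g i); [by [] | rewrite (subr0_eq e1)].
have N0' : N%:Z != 0 by lia.
(* Moving al by an element of N I makes its coordinates coprime. *)
have [s [t]] := coprimez_translate m n N%:Z N0' cop.
set m1 := m + _; set n1 := n + _ => /eqP cop1.
have [u [v uvE]] := Bezoutz m1 n1; rewrite cop1 in uvE.
pose nu := m1%:~R * x1 + n1%:~R * x2.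
(* The coordinates of (xi, nu) have determinant u m1 + v n1 = 1, so this is a basis of I. *)
pose xi := v%:~R * x1 - u%:~R * x2.
have nu0 : nu != 0.
  by apply/eqP => /indep[m10 n10]; move: uvE; rewrite m10 n10; lia.
have uv1 : u%:~R * m1%:~R = 1 - v%:~R * n1%:~R :> algC.
  have {}uvE : u * m1 = 1 - v * n1 by lia.
  by rewrite -rmorphM /= uvE; ring.
have Inu : I nu by apply: (omodZ d).
have Ixi : I xi by have := omodZ d I v (- u) _ _ mI Ix1 Ix2; congr I; rewrite /xi; ring.
have latE : lat (xi / nu) = scal nu^-1 I.
  apply: cset_eq => x; split=> [[i [j ->]]|[y [/gen[i [j ->]] ->]]].
    by exists (i%:~R * xi + j%:~R * nu); split; [exact: (omodZ d) | field].
  exists (i * n1 - j * m1), (i * u + j * v).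
  apply: (mulfI nu0); rewrite (mulVKf nu0).
  transitivity ((i * n1 - j * m1)%:~R * xi + (i * u + j * v)%:~R * nu); last by field.
  by rewrite /xi /nu; ring: uv1.
have mL : omod d (lat (xi / nu)) by rewrite latE; apply: omod_scal.
have [Q pQ QE] := omod_lat_form d _ fd d0 mL.
have [k3 k3O benuE] : exists2 k, OK d k & be * nu = 1 + N%:R * k.
  exists (kc + be * (s%:~R * x1 + t%:~R * x2)).
    by apply: OKD => //; apply: beI; apply: (omodZ d).
  have -> : nu = al + N%:R * (s%:~R * x1 + t%:~R * x2) by rewrite alE' /nu /m1 /n1; ring.
  by rewrite mulrDr bealE; ring.
have benu0 : be * nu != 0 by rewrite mulf_neq0.
exists Q; first (split; first exact: posdef_inQ).
  (* Since omega_Q lies in nu^-1 I, the product be nu omega_Q lies in be I, which is integral. *)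
  apply: (gcdz_fa_eq1 d N Q (be * nu) k3) => //.
  have : lat (omega d Q) (omega d Q) by apply: lat_gen.
  rewrite QE latE => -[y [Iy yE]].
  by rewrite yE mulrA mulfK //; exact: beI.
exists nu^-1; split; [|by rewrite invr_eq0| |by rewrite QE latE mulI_pid].
  by apply: inKV => //; apply: IK.
(* nu^-1 = be / (be nu), with numerator and denominator both congruent to 1 modulo N. *)
exists be, (be * nu); split; first exact: BO.
split; first exact: beI.
split=> //; split; first by rewrite invfM mulrA mulfV ?mul1r.
split; first by apply: int_coprime_pid => //; [exact: BO | exists kb].
split; first by apply: int_coprime_pid => //; [exact: beI | exists k3].
by exists (kb - k3); split; [exact: OKB | rewrite benuE {1}beE; ring].
Qed.

(** * Property (P) *)

Lemma SL2_1 : SL2 1%:M.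
Proof. exact: det1. Qed.

Lemma invmxM2 (g h : 'M[int]_2) :
  SL2 g -> SL2 h -> invmx (g *m h) = invmx h *m invmx g.
Proof.
move=> Sg Sh; have [Ug Uh] := (SL2_unit g Sg, SL2_unit h Sh).
have e : (g *m h) *m (invmx h *m invmx g) = 1%:M.
  by rewrite -mulmxA (mulmxA h) mulmxV // mul1mx mulmxV.
by rewrite -[LHS]mulmx1 -e mulmxA mulVmx ?mul1mx // SL2_unit //; apply: SL2M.
Qed.

Lemma fact_formK (Q : Defs.form) (g : 'M[int]_2) :
  SL2 g -> fact_form (fact_form Q g) (invmx g) = Q.
Proof. by move=> Sg; rewrite fact_formM mulmxV ?fact_form1 // SL2_unit. Qed.

Lemma isotropyP (d : int) (Q : Defs.form) (g : 'M[int]_2) : d < 0 -> posdef d Q -> SL2 g ->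
  isotropy (omega d Q) g <-> fact_form Q (invmx g) = Q.
Proof.
move=> d0 pQ Sg; have pQ' := posdef_fact d Q _ d0 (SL2V g Sg) pQ.
rewrite /isotropy mobius_omega //; split=> [[_ e]|->//].
exact: (omega_inj d).
Qed.

Lemma isotropy1 (d : int) (Q : Defs.form) :
  d < 0 -> posdef d Q -> isotropy (omega d Q) 1%:M.
Proof.
move=> d0 pQ; apply/isotropyP => //; first exact: SL2_1.
by rewrite invmx1 fact_form1.
Qed.

Lemma pid_inv (d : int) (nu mu : algC) :
  nu != 0 -> pid d (nu * mu) = OK d -> pid d mu = pid d nu^-1.
Proof. by move=> nu0 e; rewrite [RHS]pidE -e pidE scalM mulKf. Qed.

(** The inverse supplied by [subgroupIK] is principal, say (mu), and (nu mu) = O_K identifies it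
    with (nu^-1). *)
Lemma subgroup_pidV (d : int) (N : nat) (P : cset -> Prop) (nu : algC) :
  subgroupIK d N P -> (forall I, P I -> PK d N I) ->
  P (pid d nu) -> nu != 0 -> P (pid d nu^-1).
Proof.
move=> [_ _ _ PV] PPK Pnu nu0; have [J [PJ e]] := PV _ Pnu.
have [_ [mu [_ mu0 JE]]] := PPK _ PJ.
by rewrite -(pid_inv d nu mu) -?JE // -mul_pid -JE.
Qed.

Theorem theorem2p5 (d : int) (N : nat) (P : cset -> Prop)
    (G : 'M[int]_2 -> Prop) :
  fund_disc d -> d < 0 -> (0 < N)%N ->
  subgroupIK d N P ->
  (forall I, PK1 d N I -> P I) ->
  (forall I, P I -> PK d N I) ->
  subgroupSL2 G ->
  (phi_wd_bij d N P G <-> propP d N P G).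
Proof.
move=> fd d0 N0 sP PK1P PPK [GS G1 GM GV].
have PV nu : P (pid d nu) -> nu != 0 -> P (pid d nu^-1) by apply: subgroup_pidV sP PPK.
have latV Q g : inQN d N Q -> SL2 g -> jfac g (omega d Q) != 0 /\
    lat (omega d Q) = scal (jfac g (omega d Q)) (lat (omega d (fact_form Q (invmx g)))).
  move=> [/inQ_posdef pQ _] Sg; split; first exact: jfac_neq0.
  by rewrite -mobius_omega // -lat_mobius.
have equivP_lat Q Q' : inQN d N Q -> Defs.equivP P (lat (omega d Q)) (lat (omega d Q')) ->
    exists nu, [/\ P (pid d nu), nu != 0 & lat (omega d Q') = scal nu (lat (omega d Q))].
  move=> [/inQ_posdef pQ _] [H [PH ->]].
  have [_ [nu [_ nu0 HE]]] := PPK H PH; exists nu; rewrite -HE; split=> //.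
  by rewrite HE mulI_pid //; apply: omod_lat.
have lat_equivP Q Q' nu : inQN d N Q -> P (pid d nu) ->
    lat (omega d Q') = scal nu (lat (omega d Q)) ->
    Defs.equivP P (lat (omega d Q)) (lat (omega d Q')).
  move=> [/inQ_posdef pQ _] Pnu ->; exists (pid d nu); split=> //.
  by rewrite mulI_pid //; apply: omod_lat.
split=> [[_ wd inj _] Q g QN Sg Q'N|prop].
- have [pQ _] := QN; have {}pQ := inQ_posdef d Q pQ.
  have [j0 latE] := latV Q g QN Sg; split=> [Pj|[g1 [g2 [Gg1 [Sg2 fix2] gE]]]].
    have [|h [Gh Q'E]] := inj _ _ QN Q'N.
      apply: (lat_equivP _ _ (jfac g (omega d Q))^-1) => //; first exact: PV.
      by rewrite latE scalM mulVf // scal1.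
    have Sh := GS h Gh.
    (* Injectivity gives h in Gamma with Q^h = Q^(g^-1), so h g fixes Q and g = h^-1 (h g). *)
    exists (invmx h), (h *m g); split; first exact: GV.
      apply/isotropyP => //; first exact: SL2M.
      by rewrite invmxM2 // -fact_formM Q'E fact_formK.
    by rewrite mulmxA mulVmx ?mul1mx // SL2_unit.
  have Sg1 := GS g1 Gg1.
  (* The factor g2 fixes Q, so Q and Q^(g^-1) are related by g1^-1 in Gamma. *)
  have Q'E : fact_form Q (invmx g) = fact_form Q (invmx g1).
    by rewrite gE invmxM2 // -fact_formM ((isotropyP d Q g2 d0 pQ Sg2).1 (conj Sg2 fix2)).
  have [|nu [Pnu nu0 nuE]] := equivP_lat _ _ QN (wd _ _ QN Q'N _).
    by exists (invmx g1); split=> //; apply: GV.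
  (* nu j stabilises the lattice of omega_Q, hence is a unit, and (j) = (nu^-1) lies in P. *)
  rewrite (pid_inv d nu) //; first exact: PV.
  apply: (scal_lat_pid d Q) => //; first exact: mulf_neq0.
  by rewrite mulrC -scalM -nuE -latE.
split.
- by move=> Q QN; apply: IK_lat.
- move=> Q Q' QN Q'N [g [Gg Q'E]].
  have Sg := GS g Gg; have SVg := SL2V g Sg; have GVg := GV g Gg.
  have VVg : invmx (invmx g) = g by apply: invmxK.
  have [pQ _] := QN; have {}pQ := inQ_posdef d Q pQ.
  have [j0 latE] := latV Q (invmx g) QN SVg; rewrite VVg -Q'E in latE.
  apply: (lat_equivP _ _ (jfac (invmx g) (omega d Q))^-1) => //.
    (* Property (P) is applied to g^-1, which lies in Gamma, with trivial isotropy factor. *)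
    apply: PV => //; apply/prop; rewrite ?VVg -?Q'E //.
    exists (invmx g), 1%:M; split=> //; first exact: isotropy1.
    by rewrite mulmx1.
  by rewrite latE scalM mulVf // scal1.
- move=> Q Q' QN Q'N /(equivP_lat _ _ QN)[nu [Pnu nu0 e]].
  have [pQ _] := QN; have {}pQ := inQ_posdef d Q pQ.
  have [pQ' _] := Q'N; have {}pQ' := inQ_posdef d Q' pQ'.
  have [g [Sg gw jE]] := lat_scal_mobius d Q Q' nu d0 pQ pQ' e.
  have Q'E : Q' = fact_form Q (invmx g).
    apply: (omega_inj d) => //; first by apply: posdef_fact => //; apply: SL2V.
    by rewrite -gw mobius_omega.
  have jV : jfac g (omega d Q) = nu^-1 by rewrite -[LHS](mulKf nu0) jE mulr1.
  have Pj : P (pid d (jfac g (omega d Q))) by rewrite jV; apply: PV.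
  have Q'N' : inQN d N (fact_form Q (invmx g)) by rewrite -Q'E.
  (* Removing the factor g2, which fixes Q, leaves Q' = Q^(g1^-1) with g1 in Gamma. *)
  have [g1 [g2 [Gg1 [Sg2 fix2] gE]]] := (prop Q g QN Sg Q'N').1 Pj.
  have Sg1 := GS g1 Gg1; exists (invmx g1); split; first exact: GV.
  by rewrite Q'E gE invmxM2 // -fact_formM ((isotropyP d Q g2 d0 pQ Sg2).1 (conj Sg2 fix2)).
- move=> I IN; have [Q QN [nu [nuK nu0 nu1 latE]]] := IK_form d N I fd d0 N0 IN.
  exists Q; split=> //; exists (pid d nu); split=> //.
  by apply: PK1P; exists nu.
Qed.
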